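(* Let $n\ge 2$, let $a_1,\dots,a_n,b_1,\dots,b_n\in\mathbb{R}$, and let $J$ be the Jacobian of the directed $n$-node ring with these entries. Assume that, after scaling time, there is a Hopf bifurcation with eigenvalue $\mathrm{i}$; in particular $\mathrm{i}$ is an eigenvalue of $J$. Let $\phi(t)=[\phi_1(t),\dots,\phi_n(t)]^{\mathrm T}$ be the linearised eigenfunction for the eigenvalue $\mathrm{i}$. Then, taking $j \pmod n$, the phase shift $\theta_j$ from $\phi_j(t)$ to $\phi_{j+1}(t)$ is $$\theta_j = 2\pi-\arg\left(\frac{\mathrm{i}-a_j}{b_j}\right)\pmod{2\pi},\qquad j=1,\dots,n.$$
   Context: $J$ is the real $n\times n$ matrix with $J_{jj}=a_j$ for $1\le j\le n$, $J_{j,j+1}=b_j$ for $1\le j\le n-1$, $J_{n,1}=b_n$, and all other entries $0$ (the Jacobian at an equilibrium of $\dot x_j=f_j(x_j,x_{j+1})$, indices mod $n$, $x_j\in\mathbb{R}$). Indices are read mod $n$ with $0$ replaced by $n$, so $\phi_{n+1}=\phi_1$. If $\mathrm{i}$ is an eigenvalue of $J$ then every $b_j$ is nonzero, so the quotients make sense. The linearised eigenfunction is $\phi(t)=e^{\mathrm{i}t}u$ where $u=[u_1,\dots,u_n]^{\mathrm T}\in\mathbb{C}^n$ is an eigenvector of $J$ for the eigenvalue $\mathrm{i}$. The argument $\arg z$ of a nonzero complex number is taken in $[0,2\pi)$. Phase shifts are elements of $\mathbb{R}/2\pi\mathbb{Z}$: for a $2\pi$-periodic $\rho$, the phase shift from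 $\rho(t)$ to $\rho(t-\theta)$ is $\theta$, and amplitudes are ignored, so the phase shift from $\phi_j$ to $\phi_k$ is the $\theta$ for which $\phi_k(t)=r\,\phi_j(t-\theta)$ for all $t$ with some $r>0$. *)

(* Defs.v *)
From HB Require Import structures.
From mathcomp Require Import all_boot all_order all_algebra.
From mathcomp Require Import all_classical all_reals all_analysis.
From mathcomp Require Import complex.

Set Implicit Arguments.
Unset Strict Implicit.
Unset Printing Implicit Defensive.

Import Order.TTheory GRing.Theory Num.Theory.

Local Open Scope classical_set_scope.
Local Open Scope ring_scope.
Local Open Scope complex_scope.

Section Defs.
Context {R : realType}.

(* The nodes 1, ..., n are the elements 0, ..., n-1 of 'I_n, and the node
   following j (mod n) is ordS j. The two cases below overlap only for n = 1. *)
Definition ring_jacobian (n : nat) (a b : 'I_n -> R) : 'M[R]_n :=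
  \matrix_(j, k) (if k == j then a j else if k == ordS j then b j else 0).

(* A real matrix acting on C^n. *)
Definition complexify (m n : nat) (A : 'M[R]_(m, n)) : 'M[R[i]]_(m, n) :=
  map_mx (real_complex R) A.

(* Column-vector convention, unlike mathcomp's eigenvalue and eigenspace. *)
Definition is_eigenvector (n : nat) (A : 'M[R[i]]_n) (z : R[i])
    (u : 'cV[R[i]]_n) : Prop :=
  u != 0 /\ A *m u = z *: u.

(* e^(i t) *)
Definition expi (t : R) : R[i] := cos t +i* sin t.

(* The argument in [0, 2 pi); the value at z = 0 is irrelevant. *)
Definition arg (z : R[i]) : R :=
  xget 0 [set t : R | 0 <= t < 2 * pi /\ z = `|z| * expi t].

(* The solution t |-> e^(i t) u of the linearised equation. *)
Definition eigenfunction (n : nat) (u : 'cV[R[i]]_n) (t : R) : 'cV[R[i]]_n :=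
  expi t *: u.

Definition component (n : nat) (phi : R -> 'cV[R[i]]_n) (j : 'I_n) : R -> R[i] :=
  fun t => phi t j 0.

(* x and y represent the same element of R / 2 pi Z. *)
Definition eq_mod_2pi (x y : R) : Prop :=
  exists m : int, x = y + m%:~R * (2 * pi).

(* theta represents the phase shift from f to g, amplitudes being ignored. *)
Definition phase_shift (f g : R -> R[i]) (theta : R) : Prop :=
  exists2 r : R, 0 < r & forall t : R, g t = r%:C * f (t - theta).

End Defs.

(* Main.v *)
Require Import Defs.
From HB Require Import structures.
From mathcomp Require Import all_boot all_order all_algebra.
From mathcomp Require Import all_classical all_reals all_analysis.
From mathcomp Require Import complex.
From mathcomp Require Import ring lra.

Set Implicit Arguments.
Unset Strict Implicit.
Unset Printing Implicit Defensive.

Import Order.TTheory GRing.Theory Num.Theory.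

Local Open Scope ring_scope.
Local Open Scope complex_scope.

(* Row j of J u = i u reads b_j u_(j+1) = (i - a_j) u_j, and a_j is real, so a
   zero entry of u would propagate backwards around the ring; hence no u_j and
   no b_j vanishes and phi_(j+1) = z phi_j with z = (i - a_j) / b_j. Shifting
   phi_j by theta multiplies it by e^(-i theta), so theta is the phase shift
   iff z e^(i theta) is a positive real, i.e. iff theta = - arg z mod 2 pi. *)

Lemma expi0 (R : realType) : expi 0 = 1 :> R[i].
Proof. by rewrite /expi cos0 sin0. Qed.

Lemma expiD (R : realType) (x y : R) : expi (x + y) = expi x * expi y.
Proof.
rewrite /expi cosD sinD; apply/eqP; rewrite eq_complex /= eqxx /=.
by rewrite addrC [sin x * _]mulrC [_ * sin x]mulrC mulrC.
Qed.

Lemma expiNK (R : realType) (x : R) : expi x * expi (- x) = 1.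
Proof. by rewrite -expiD subrr expi0. Qed.

Lemma expi_neq0 (R : realType) (x : R) : expi x != 0.
Proof.
apply/eqP => ex0; have /eqP := expiNK x.
by rewrite ex0 mul0r eq_sym oner_eq0.
Qed.

Lemma normc_expi (R : realType) (x : R) : `|expi x| = 1.
Proof. by rewrite normc_def /= cos2Dsin2 sqrtr1. Qed.

Lemma expi_2pi (R : realType) : expi (2 * pi) = 1 :> R[i].
Proof. by rewrite mulr_natl /expi cos2pi sin2pi. Qed.

Lemma expi_int_2pi (R : realType) (m : int) : expi (m%:~R * (2 * pi)) = 1 :> R[i].
Proof.
have nat_case k : expi (k%:R * (2 * pi)) = 1 :> R[i].
  by elim: k => [|k IHk]; rewrite ?mul0r ?expi0// -natr1 mulrDl mul1r expiD IHk
    expi_2pi mulr1.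
case: m => k; first exact: nat_case.
rewrite NegzE mulrNz mulNr -[LHS]mul1r.
by rewrite -{1}(nat_case k.+1) expiNK.
Qed.

Lemma reduce_mod_2pi (R : realType) (x : R) :
  exists2 y, 0 <= y < 2 * pi & eq_mod_2pi x y.
Proof.
have pi2_gt0 : 0 < 2 * pi :> R by rewrite mulr_gt0// pi_gt0.
set m := Num.floor (x / (2 * pi)).
exists (x - m%:~R * (2 * pi)); last by exists m; rewrite subrK.
have /andP[] := floor_itv (x / (2 * pi)); rewrite -/m intrD => mle mgt.
rewrite subr_ge0 -ler_pdivlMr// mle /= ltrBlDr -[X in X + _]mul1r -mulrDl.
by rewrite -ltr_pdivrMr// addrC.
Qed.

(** The sine vanishes nowhere on (0, pi), nor on (pi, 2 pi) after a shift by pi, and at pi the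
    cosine is -1. *)
Lemma expi_eq1 (R : realType) (x : R) : 0 <= x < 2 * pi -> expi x = 1 -> x = 0.
Proof.
move=> /andP[x_ge0 x_lt] [cosx sinx].
have pi_gt0 := pi_gt0 R.
have [x_gt0|x_le0] := ltP 0 x; last by apply/eqP; rewrite eq_le x_le0.
have [x_lt_pi|x_gt_pi|x_pi] := ltgtP x pi.
- by have := @sin_gt0_pi R x; rewrite x_gt0 x_lt_pi sinx ltxx => /(_ isT).
- have := @sin_gt0_pi R (x - pi); rewrite sinB cospi sinpi sinx.
  rewrite mul0r mulr0 subr0 ltxx => F.
  by suff: false by []; apply: F; lra.
- by move: cosx; rewrite x_pi cospi => F; suff: false by []; lra.
Qed.

Lemma expi_eq (R : realType) (x y : R) : expi x = expi y <-> eq_mod_2pi x y.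
Proof.
split=> [exy|[m ->]]; last by rewrite expiD expi_int_2pi mulr1.
(* The remainder [d] of x - y also satisfies [expi d = 1], and on [0, 2 pi) this leaves only 0. *)
have [d d_itv [m xyE]] := reduce_mod_2pi (x - y).
exists m; rewrite -[LHS](subrK y) xyE addrAC.
suff -> : d = 0 by rewrite add0r.
apply: expi_eq1 => //; transitivity (expi d * expi (m%:~R * (2 * pi))).
  by rewrite expi_int_2pi mulr1.
by rewrite -expiD -xyE expiD exy expiNK.
Qed.

(** The angle [acos x] has cosine x and sine |y|, so the sign of y chooses between [acos x] and
    [- acos x]. *)
Lemma unit_circle_expi (R : realType) (x y : R) :
  x ^+ 2 + y ^+ 2 = 1 -> exists t, x +i* y = expi t.
Proof.
move=> xy1; have x_itv : -1 <= x <= 1 by nra.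
have sqrE : Num.sqrt (1 - x ^+ 2) = `|y|.
  by rewrite -xy1 addrC addKr sqrtr_sqr.
have cosE : cos (acos x) = x by have [] := acos_def x_itv.
have [y_ge0|y_lt0] := leP 0 y.
  by exists (acos x); rewrite /expi cosE sin_acos// sqrE ger0_norm.
by exists (- acos x); rewrite /expi cosN sinN cosE sin_acos// sqrE ltr0_norm//
  opprK.
Qed.

(** The point is that the set from which [arg] chooses is nonempty, so the default of [xget] is
    never returned. *)
Lemma arg_polar (R : realType) (z : R[i]) : z = `|z| * expi (arg z).
Proof.
rewrite /arg; case: xgetP => [t _ [] //|noarg].
exfalso; suff [t zE] : exists t, z = `|z| * expi t.
  have [s s_itv /expi_eq ts] := reduce_mod_2pi t.
  by apply: (noarg s); split=> //; rewrite -ts.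
have [->|z_neq0] := eqVneq z 0; first by exists 0; rewrite normr0 mul0r.
have norm_neq0 : `|z| != 0 by rewrite normr_eq0.
case wE: (z / `|z|) => [x y].
have [|t wt] := @unit_circle_expi R x y.
  have : `|z / `|z| | ^+ 2 = 1 by rewrite normrM normfV normr_id divff// expr1n.
  by rewrite wE normc_def /= -rmorphXn /= sqr_sqrtr ?addr_ge0 ?sqr_ge0// => -[].
by exists t; rewrite -wt -wE mulrC divfK.
Qed.

(** Walk backwards from j down to 0, wrap once to the last index, then walk down to k. *)
Lemma ordS_stable_all (n : nat) (P : 'I_n -> Prop) (j : 'I_n) :
  (forall k, P (ordS k) -> P k) -> P j -> forall k, P k.
Proof.
case: n P j => [|n] P j Ppred Pj k; first by case: j Pj.
(* Descent without wrap-around: as long as i < l, [ordS i] is the plain successor. *)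
have down d (i l : 'I_n.+1) : l = (i + d)%N :> nat -> P l -> P i.
  elim: d i => [|d IHd] i li Pl.
    by rewrite (_ : i = l)//; apply: val_inj; rewrite /= li addn0.
  apply: Ppred; apply: IHd Pl; rewrite /= modn_small ?addSnnS//.
  by have := ltn_ord l; rewrite li addnS; apply: leq_trans; rewrite !ltnS leq_addr.
apply: (down (n - k)%N _ ord_max); first by rewrite /= subnKC// -ltnS.
apply: Ppred; rewrite (_ : ordS ord_max = ord0).
  by apply: (down j _ j).
by apply: val_inj; rewrite /= modnn.
Qed.

(** Two nodes suffice for [ordS j] to differ from j; on a single node the diagonal case would hide
    [b j]. *)
Lemma ring_jacobian_row (R : realType) (n : nat) (a b : 'I_n -> R)
    (u : 'cV[R[i]]_n) (j : 'I_n) : (2 <= n)%N ->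
  (complexify (ring_jacobian a b) *m u) j 0 =
  (a j)%:C * u j 0 + (b j)%:C * u (ordS j) 0.
Proof.
move=> n_ge2; have Sj : ordS j != j.
  rewrite -val_eqE /=; have := ltn_ord j; rewrite leq_eqVlt => /predU1P[jn|ltSj].
    by rewrite jn modnn; apply: contraTneq n_ge2 => j0; rewrite -jn -j0.
  by rewrite modn_small// neq_ltn ltnSn orbT.
rewrite mxE (bigD1 j)//= (bigD1 (ordS j))//= !mxE eqxx (negPf Sj) eqxx.
by rewrite big1 ?addr0// => k /andP[/negPf kj /negPf kSj]; rewrite !mxE kj kSj mul0r.
Qed.

Theorem proposition4p3 (R : realType) (n : nat) (hn : (2 <= n)%N)
    (a b : 'I_n -> R) (u : 'cV[R[i]]_n)
    (hu : is_eigenvector (complexify (ring_jacobian a b)) 'i%C u) :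
  forall (j : 'I_n) (theta : R),
    phase_shift (component (eigenfunction u) j)
                (component (eigenfunction u) (ordS j)) theta <->
    eq_mod_2pi theta (2 * pi - arg (('i%C - (a j)%:C) / (b j)%:C)).
Proof.
case: hu => u_neq0 Ju j theta.
have row k : (b k)%:C * u (ordS k) 0 = ('i%C - (a k)%:C) * u k 0.
  move/matrixP/(_ k 0): Ju; rewrite ring_jacobian_row// mxE mulrBl => <-.
  by rewrite addrAC subrr add0r.
have ia_neq0 k : 'i%C - (a k)%:C != 0.
  by rewrite eq_complex /= subr0 oner_eq0 andbF.
have u_neq0j k : u k 0 != 0.
  apply: contra_neq u_neq0 => uk0; apply/matrixP => i c.
  (* Backward propagation divides only by i - a_l; going forward would divide by b_l, not yet known
     to be nonzero. *)
  rewrite ord1 mxE; apply: (ordS_stable_all (P := fun i => u i 0 = 0)) uk0 i.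
  move=> l ul; have /eqP := row l.
  by rewrite ul mulr0 eq_sym mulf_eq0 (negPf (ia_neq0 l)) => /eqP.
have b_neq0 : (b j)%:C != 0.
  apply/eqP => b0; have /eqP := row j.
  by rewrite b0 mul0r eq_sym mulf_eq0 (negPf (ia_neq0 j)) (negPf (u_neq0j j)).
set z := ('i%C - (a j)%:C) / (b j)%:C.
have uS : u (ordS j) 0 = z * u j 0.
  by apply: (mulfI b_neq0); rewrite row mulrA /z [_ * (_ / _)]mulrC divfK.
have z_neq0 : z != 0 by rewrite mulf_neq0 ?invr_eq0.
apply: iff_trans (expi_eq _ _).
rewrite expiD expi_2pi mul1r.
split=> [[r r_gt0 shift]|thetaE].
- have zE : expi theta * z = r%:C.
    apply: (mulIf (u_neq0j j)); rewrite -mulrA -uS.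
    (* At time [theta] the shifted component is taken at time 0, where it equals u_j. *)
    by have := shift theta; rewrite /component /eigenfunction !mxE subrr expi0 mul1r.
  (* Taking norms identifies the amplitude ratio r as |z|, which then cancels from the polar form of
     z. *)
  have norm_z : `|z| = r%:C.
    by rewrite -[LHS]mul1r -(normc_expi theta) -normrM zE ger0_norm// ler0c ltW.
  apply: (mulfI (expi_neq0 (arg z))); rewrite expiNK.
  have r_neq0 : r%:C != 0 by rewrite -norm_z normr_eq0.
  apply: (mulfI r_neq0); rewrite mulr1 -[RHS]zE {2}[z]arg_polar norm_z.
  by rewrite mulrA mulrC.
(* The amplitude ratio must be |z|; the norm takes values in [R[i]], so a real r representing it is
   extracted first. *)
- have [r normE] : exists r, `|z| = r%:C by rewrite normc_def; eexists.
  exists r; first by rewrite -ltcR -normE normr_gt0.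
  move=> t; rewrite /component /eigenfunction !mxE uS {1}[z]arg_polar normE.
  rewrite expiD.
  suff -> : expi (- theta) = expi (arg z) by ring.
  apply: (mulfI (expi_neq0 theta)).
  by rewrite expiNK thetaE mulrC expiNK.
Qed.
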